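(* Let $(X_\alpha)_{\alpha\in A}$ be a family of topological spaces such that, for each $\alpha\in A$, each $x\in X_\alpha$ has a neighbourhood basis consisting of closed, quasi-compact neighbourhoods of $x$ in $X_\alpha$. Let $Y$ be a topological space such that each $y\in Y$ has a neighbourhood basis consisting of closed neighbourhoods of $y$ in $Y$. Endow $X:=\prod_{\alpha\in A}X_\alpha$ with the product topology and let $f\colon X\to Y$ be a map such that the restriction $f|_K$ is continuous for each quasi-compact subset $K\subseteq X$. Then $f$ is continuous.
   Context: Terminology follows Bourbaki. A topological space (or a subset with its subspace topology) is quasi-compact if every open cover has a finite subcover; no Hausdorff condition is imposed. A neighbourhood of a point is a set containing an open set that contains the point (it need not itself be open). The spaces $X_\alpha$ and $Y$ are not assumed Hausdorff, and the index set $A$ is arbitrary. Subsets $K\subseteq X$ carry the subspace topology. *)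

(* Defs.v *)
From HB Require Import structures.
From mathcomp Require Import all_boot all_order all_algebra.
From mathcomp Require Import all_classical all_reals all_analysis.

Set Implicit Arguments.
Unset Strict Implicit.
Unset Printing Implicit Defensive.

Local Open Scope classical_set_scope.

(* Members of the basis are neighbourhoods in Bourbaki's sense: they need not
   be open, as opposed to the library's [basis]. *)
Definition nbhs_basis (T : topologicalType) (x : T) (B : set (set T)) : Prop :=
  B `<=` nbhs x /\ filter_from B id --> x.

(* Main.v *)
(** Let [V <= interior W] be closed neighbourhoods of [f x], and let [Q] be a
    product of compact neighbourhoods of the [x a]; on [Q], [f] takes values in
    [V] near [x], say on the points constrained in the coordinates in a finite
    set [S0] only.  If [f @^-1` W] contained no neighbourhood of [x], one could
    pick recursively finite sets [S0 <= S 1 <= S 2 ...] and points [y n] with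
    [f (y n)] outside [W] that are constrained as above in the coordinates in
    [S n] and equal to [x] outside [S n.+1].  Let [z n] agree with [y n] on
    [S n] and with [x] elsewhere, so that [f (z n)] lies in [V].  In each
    coordinate [y] and [z] eventually agree, and both sequences lie in a common
    product of compact sets; at a cluster point [p] of [z] in it, the continuity
    of [f] yields [f p \in V] from [z], but [f p \notin interior W] from [y]. *)

Require Import Defs.
From HB Require Import structures.
From mathcomp Require Import all_boot all_order all_algebra.
From mathcomp Require Import finmap.
From mathcomp Require Import all_classical all_reals all_analysis.

Local Open Scope classical_set_scope.

(* The library has this for pointed spaces only. *)
Lemma cover_compactP (T : topologicalType) (K : set T) :
  cover_compact K <-> compact K.
Proof.
have [[t]|T0] := pselect (inhabited T).
  pose P : ptopologicalType := HB.pack (Topological.sort T) (isPointed.Build T t).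
  by rewrite (_ : compact K = @cover_compact P K) // -(@compact_cover P).
have noT (t : T) : False by apply: T0.
split=> [_ F FF _|_ I D g _ _]; first by have [t] := @filter_ex _ F FF _ filterT.
by exists fset0 => // t; have := noT t.
Qed.

Section ProductOfFamily.
Context {A : Type} {X : A -> topologicalType}.
Implicit Types (x y : prod_topology X) (S : set A).

Definition splice S y x : prod_topology X :=
  fun a => if pselect (S a) then y a else x a.

Lemma splice_in S y x a : S a -> splice S y x a = y a.
Proof. by rewrite /splice; case: pselect. Qed.

Lemma splice_out S y x a : ~ S a -> splice S y x a = x a.
Proof. by rewrite /splice; case: pselect. Qed.

Lemma cover_compact_prod (K : forall a, set (X a)) :
  (forall a, compact (K a)) ->
  cover_compact [set y : prod_topology X | forall a, K a (y a)].
Proof.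
by move=> Kc; apply/cover_compactP; exact: (@tychonoff {classic A} X).
Qed.

(** The product topology is the supremum of the topologies induced by the projections, so
    convergence to [x] of the filter [G] of sets containing such a box can be tested one coordinate
    at a time. *)
Lemma nbhs_prodP x (U : set (prod_topology X)) :
  nbhs x U <-> exists S (N : forall a, set (X a)),
    [/\ finite_set S, forall a, nbhs (x a) (N a) &
        forall y, (forall a, S a -> N a (y a)) -> U y].
Proof.
split.
  pose G : set_system (prod_topology X) := fun V => exists S (N : forall a, set (X a)),
    [/\ finite_set S, forall a, nbhs (x a) (N a) &
        forall y, (forall a, S a -> N a (y a)) -> V y].
  have GF : Filter G.
    split.
    - by exists set0, (fun=> setT); split=> // a; exact: filterT.
    - move=> P Q [S [N [fS nN NP]]] [S' [N' [fS' nN' NQ]]].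
      exists (S `|` S'), (fun a => N a `&` N' a); split.
      + by rewrite finite_setU.
      + by move=> a; exact: filterI.
      + by move=> y Ny; split; [apply: NP|apply: NQ] => a Sa;
          have [] // := Ny a; [left|right].
    - move=> P Q PQ [S [N [fS nN NP]]]; exists S, N; split=> // y /NP.
      exact: PQ.
  have : G --> x; last exact.
  apply/cvg_sup => i U' [_ [[V oV <-] Vx] VU'].
  (* Membership in [V] makes sense in [X i] only, hence the transport along [a = i]; the condition
     is void for other [a]. *)
  exists [set i], (fun a => [set t | forall e : a = i, V (ecast i (X i) e t)]).
  split=> [//|a|y /(_ _ erefl)/(_ erefl) Vy]; last exact: VU'.
  have [ai|nai] := pselect (a = i); last first.
    by apply: filterS (@filterT _ (nbhs (x a)) _) => t _ e.
  subst a; apply: filterS (open_nbhs_nbhs (conj oV Vx)) => t Vt e.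
  by rewrite (Prop_irrelevance e erefl).
move=> [S [N [fS nN NU]]].
have : nbhs x (\bigcap_(a in [set` fset_set (S : set {classic A})])
    [set y : prod_topology X | N a (y a)]).
  apply: filter_bigI => a _.
  exact: (@proj_continuous {classic A} X a x _ (nN a)).
apply: filterS => y Ny; apply: NU => a Sa; apply: (Ny a).
by rewrite /= in_fset_set// inE.
Qed.

(* The restriction of [f] to the compact set of the points that agree with [x]
   or with [y] in each coordinate is continuous at [y]. *)
Lemma splice_approx (Y : topologicalType) (f : prod_topology X -> Y)
    (hf : forall K : set (prod_topology X),
      cover_compact K -> {within K, continuous f}) x y (U : set Y) :
  nbhs (f y) U ->
  exists S, finite_set S /\ forall S', S `<=` S' -> U (f (splice S' y x)).
Proof.
move=> Ufy; pose K a := [set x a; y a].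
have Kc : cover_compact [set w : prod_topology X | forall a, K a (w a)].
  by apply: cover_compact_prod => a; apply: finite_compact; exact: finite_set2.
have Ky : [set w : prod_topology X | forall a, K a (w a)] y by move=> a; right.
have /subspace_continuousP/(_ y Ky U Ufy) := hf _ Kc.
move=> /nbhs_prodP [S [N [fS nN NU]]]; exists S; split=> // S' SS'.
apply: NU => [a /SS' Sa|a]; first by rewrite splice_in//; exact: nbhs_singleton.
have [Sa|Sa] := pselect (S' a); first by right; exact: splice_in.
by left; exact: splice_out.
Qed.

Lemma seq_values_meet (Y : topologicalType) (f : prod_topology X -> Y)
    (hf : forall K : set (prod_topology X),
      cover_compact K -> {within K, continuous f})
    (K : forall a, set (X a)) (y z : nat -> prod_topology X) (V W : set Y) :
  (forall a, compact (K a)) ->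
  (forall n a, K a (y n a)) -> (forall n a, K a (z n a)) ->
  (forall a, exists N, forall n, (N <= n)%N -> y n a = z n a) ->
  closed V -> V `<=` W^° -> (forall n, V (f (z n))) ->
  exists n, W (f (y n)).
Proof.
move=> Kc Ky Kz yz cV VW Vz.
have PKc := cover_compact_prod K Kc.
have [p [Kp zp]] := (@cover_compactP _ _).1 PKc (z @ \oo) _
  (filterS (fun n _ => Kz n) filterT).
have /subspace_continuousP/(_ p Kp) fp := hf _ PKc.
have Vp : V (f p).
  apply: cV => U /fp Up.
  have [|q [[n _ <-] /(_ (Kz n)) Uq]] := zp (range z) _ _ Up.
    by apply: (@filterS _ \oo _ setT) => [n _|]; [exists n|exact: filterT].
  by exists (f (z n)).
have /nbhs_prodP [S [N [fS nN NW]]] := fp W (VW _ Vp).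
have [M yzM] := choice yz.
(* The thresholds [M a] need a common bound on the finite set [S] only; [z] clusters at [p] along
   the tail beyond it too. *)
have [m Mm] : exists m, forall a, S a -> (M a <= m)%N.
  exists (\max_(a <- fset_set (S : set {classic A})) M a) => a Sa.
  by apply: (@leq_bigmax_seq {classic A}) => //; rewrite in_fset_set// in_setE.
have : nbhs p [set q : prod_topology X | forall a, S a -> N a (q a)].
  by apply/nbhs_prodP; exists S, N.
move=> /(zp (z @` [set n | (m <= n)%N])).
case; first by exists m => // n mn; exists n.
move=> _ [[n mn <-] Nz]; exists n; apply: (NW (y n)) (Ky n) => a Sa.
by rewrite yzM; [exact: Nz|exact: leq_trans (Mm _ Sa) mn].
Qed.

End ProductOfFamily.

Theorem mainTheorem1 (A : Type) (X : A -> topologicalType) (Y : topologicalType)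
  (hX : forall (a : A) (x : X a), exists2 B : set (set (X a)),
      nbhs_basis x B & forall V, B V -> closed V /\ cover_compact V)
  (hY : forall y : Y, exists2 B : set (set Y),
      nbhs_basis y B & forall V, B V -> closed V)
  (f : prod_topology X -> Y)
  (hf : forall K : set (prod_topology X),
      cover_compact K -> {within K, continuous f}) :
  continuous f.
Proof.
have Yreg (t : Y) U : nbhs t U -> exists V, [/\ closed V, nbhs t V & V `<=` U].
  have [B [Bn BU] Bc] := hY t.
  by move=> /BU [V BV VU]; exists V; split=> //; [exact: Bc|exact: Bn].
move=> x W0 /Yreg [W [cW nW WW0]].
have [V [cV nV VW]] := Yreg _ _ (nbhs_interior nW).
have [C Cx] : exists C : forall a, set (X a),
    forall a, compact (C a) /\ nbhs (x a) (C a).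
  suff ex a : exists C : set (X a), compact C /\ nbhs (x a) C.
    by exists (fun a => projT1 (cid (ex a))) => a; exact: projT2 (cid (ex a)).
  have [B [Bn /(_ _ filterT)[D BD _]] Bc] := hX a (x a).
  by exists D; split; [apply/cover_compactP; have [] := Bc _ BD|exact: Bn].
have CC a := (Cx a).1; have nC a := (Cx a).2.
have xC a : C a (x a) by exact: nbhs_singleton.
have /subspace_continuousP/(_ x xC V nV) := hf _ (cover_compact_prod C CC).
move=> /nbhs_prodP [S0 [N0 [fS0 nN0 NV]]].
(* Constrained coordinates thus also stay in the compact sets [C a]. *)
pose N a := N0 a `&` C a.
have nN a : nbhs (x a) (N a) by exact: filterI.
suff [S [fS SW]] : exists S, finite_set S /\
    forall y, (forall a, S a -> N a (y a)) -> W (f y).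
  apply/nbhs_prodP; exists S, N; split=> // y Ny; apply: WW0; exact: SW.
apply: contrapT => nS.
(* Finiteness of [S] is assumed inside the existential so that [choice] yields a total [g]; infinite
   [S] get a default value. *)
have step S : exists p : set A * prod_topology X, finite_set S ->
    [/\ finite_set p.1, S `<=` p.1, forall a, S a -> N a (p.2 a),
        forall a, ~ p.1 a -> p.2 a = x a & ~ W (f p.2)].
  have [fS|] := pselect (finite_set S); last by exists (S, x).
  have [y Ny nWy] : exists2 y : prod_topology X,
      forall a, S a -> N a (y a) & ~ W (f y).
    apply: contrapT => nex; apply: nS; exists S; split=> // y Ny.
    by apply: contrapT => nWy; apply: nex; exists y.
  (* The complement of [W] is open, so [y] can be reset to [x] off a finite set with its image still
     outside [W]; keeping [S] in that set preserves the constraints. *)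
  have [S1 [fS1 SW]] :=
    splice_approx Y f hf x y _ (open_nbhs_nbhs (conj (closed_openC cW) nWy)).
  exists (S `|` S1, splice (S `|` S1) y x) => _ /=; split.
  - by rewrite finite_setU.
  - by move=> a; left.
  - by move=> a Sa; rewrite splice_in; [exact: Ny|left].
  - exact: splice_out.
  - by apply: SW => a; right.
have {step} [g gP] := choice step.
pose S n := iter n (fst \o g) S0.
pose y n := (g (S n)).2.
pose z n := splice (S n) (y n) x.
have fS n : finite_set (S n).
  by elim: n => [//|n /gP[]].
have SS n : S n `<=` S n.+1 by have [] := gP _ (fS n).
have Sle n m : (n <= m)%N -> S n `<=` S m.
  elim: m => [|m IH]; first by rewrite leqn0 => /eqP->.
  by rewrite leq_eqVlt => /orP[/eqP->//|/IH nm]; exact: subset_trans nm (SS m).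
have Ny n a : S n a -> N a (y n a) by have [_ _ + _ _] := gP _ (fS n); exact.
have yx n a : ~ S n.+1 a -> y n a = x a.
  by have [_ _ _ + _] := gP _ (fS n); exact.
have nWy n : ~ W (f (y n)) by have [] := gP _ (fS n).
have Cz n a : C a (z n a).
  rewrite /z; have [Sa|Sa] := pselect (S n a).
    by rewrite splice_in//; have [] := Ny _ _ Sa.
  by rewrite splice_out.
(* The added set is finite: if [a] is in [S m], only stages [n < m] contribute; if [a] is in no
   [S n], every [y n a] is [x a]. *)
pose K a := C a `|` [set y n a | n in [set n | ~ S n a]].
have [] // := @seq_values_meet A X Y f hf K y z V W.
- move=> a; apply: compactU => //; apply: finite_compact.
  have [[m Sma]|nSa] := pselect (exists m, S m a).
    apply/finite_image/(sub_finite_set _ (finite_II m)) => n nSn /=.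
    by rewrite ltnNge; apply/negP => mn; apply: nSn; exact: Sle Sma.
  apply: (sub_finite_set _ (finite_set1 (x a))) => _ [n _ <-].
  by rewrite /= yx// => Sa; apply: nSa; exists n.+1.
- move=> n a; have [Sa|Sa] := pselect (S n a); last by right; exists n.
  by left; have [] := Ny _ _ Sa.
- by move=> n a; left.
(* [y n] and [z n] can differ only on [S n.+1] minus [S n], and each [a] lies in at most one of
   these differences. *)
- move=> a; have [[m Sma]|nSa] := pselect (exists m, S m a).
    by exists m => n mn; rewrite /z splice_in//; exact: Sle Sma.
  exists 0 => n _; rewrite /z splice_out ?yx// => Sa; apply: nSa.
    by exists n.+1.
  by exists n.
- move=> n; apply: (NV _ _ (Cz n)) => a S0a.
  have Sa : S n a by exact: (Sle 0 n) S0a.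
  by rewrite /z splice_in//; have [] := Ny _ _ Sa.
Qed.
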